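(* Define $Kii:\mathbb{R}_+^3\to\mathbb{R}$ by $Kii(a,b,c)=1-\min\left(\frac{b}{ac},\frac{ac}{b}\right)$. Then $Kii$ is a triad inconsistency indicator.
   Context: $\mathbb{R}_+$ denotes the set of strictly positive real numbers. A function $td:\mathbb{R}_+^3\to[0,+\infty)$ is a triad deviation if there exists a metric $d$ on $\mathbb{R}_+$ such that $td(x,y,z)=d(xz,y)$ for all $x,y,z\in\mathbb{R}_+$. A triad deviation is bounded if there is $M>0$ with $td(a,b,c)\le M$ for all $a,b,c\in\mathbb{R}_+$. A triad inconsistency indicator is a bounded triad deviation $ii$ with $ii(a,b,c)\le 1$ for all $a,b,c\in\mathbb{R}_+$. *)

(* Defs.v *)
From mathcomp Require Import all_boot all_order all_algebra.
From mathcomp Require Import interval_inference reals topology.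

Set Implicit Arguments.
Unset Strict Implicit.
Unset Printing Implicit Defensive.

Import Order.TTheory GRing.Theory Num.Theory.
Local Open Scope ring_scope.

(* The record [isMetric R T] of MathComp-Analysis is a distance on [T] together
   with the metric axioms; its inhabitants are thus the metrics on [T].
   The first conjunct says that [td] takes its values in [0, +oo[. *)
Definition triad_deviation (R : realType)
    (td : {posnum R} -> {posnum R} -> {posnum R} -> R) : Prop :=
  (forall x y z : {posnum R}, 0 <= td x y z) /\
  exists d : isMetric R {posnum R}, forall x y z : {posnum R},
    td x y z = isMetric.mdist d (x%:num * z%:num)%:pos y.

Definition bounded_triad_deviation (R : realType)
    (td : {posnum R} -> {posnum R} -> {posnum R} -> R) : Prop :=
  triad_deviation td /\
  exists2 M : R, 0 < M & forall a b c : {posnum R}, td a b c <= M.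

Definition triad_inconsistency_indicator (R : realType)
    (ii : {posnum R} -> {posnum R} -> {posnum R} -> R) : Prop :=
  bounded_triad_deviation ii /\ forall a b c : {posnum R}, ii a b c <= 1.

Definition Kii (R : realType) (a b c : {posnum R}) : R :=
  1 - Num.min (b%:num / (a%:num * c%:num)) (a%:num * c%:num / b%:num).

(* Main.v *)
Require Import Defs.
From mathcomp Require Import all_boot all_order all_algebra.
From mathcomp Require Import interval_inference reals topology.
From mathcomp Require Import lra.

(** The distance [d x y = 1 - s x y], with [s x y = min (y / x) (x / y)], induces
    [Kii]. Since [s x y * s y z] is at most both [z / x] and [x / z], [s] is
    supermultiplicative; the triangle inequality then follows from
    [(1 - s x y) * (1 - s y z) >= 0]. *)

Set Implicit Arguments.
Unset Strict Implicit.
Unset Printing Implicit Defensive.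

Import Order.TTheory GRing.Theory Num.Theory.
Local Open Scope ring_scope.

Section MinRatio.
Variable R : realFieldType.
Implicit Types x y z : {posnum R}.

Definition min_ratio x y : R := Num.min (y%:num / x%:num) (x%:num / y%:num).

Lemma min_ratio_ge0 x y : 0 <= min_ratio x y.
Proof. by rewrite le_min !divr_ge0. Qed.

Lemma min_ratioC x y : min_ratio x y = min_ratio y x.
Proof. exact: minC. Qed.

Lemma min_ratio_le1 x y : min_ratio x y <= 1.
Proof.
(* Clearing denominators leaves [y <= x] or [x <= y]. *)
by rewrite ge_min !ler_pdivrMr // !mul1r; exact: le_total.
Qed.

Lemma min_ratioxx x : min_ratio x x = 1.
Proof. by rewrite /min_ratio minxx divff. Qed.

Lemma min_ratio_eq1 x y : min_ratio x y = 1 -> x = y.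
Proof.
move=> s1; have : 1 <= min_ratio x y by rewrite s1.
rewrite le_min !ler_pdivlMr // !mul1r => /andP[xy yx].
(* Both ratios being at least 1 gives [x <= y] and [y <= x]. *)
by apply/val_inj/le_anti; rewrite /= xy yx.
Qed.

Lemma min_ratioM_le x y z : min_ratio x y * min_ratio y z <= min_ratio x z.
Proof.
(* Factor [b / a] through [y]; each [min_ratio] is at most the matching factor. *)
have leM (a b : {posnum R}) : min_ratio a y * min_ratio y b <= b%:num / a%:num.
  have -> : b%:num / a%:num = (y%:num / a%:num) * (b%:num / y%:num) :> R.
    by rewrite [RHS]mulrC mulrA divfK.
  by apply: ler_pM; rewrite ?min_ratio_ge0 // ge_min lexx.
(* The bound by [x / z] is [leM] with endpoints swapped, by symmetry of [min_ratio]. *)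
by rewrite le_min leM mulrC (min_ratioC y z) (min_ratioC x y) leM.
Qed.

Definition min_ratio_dist x y : R := 1 - min_ratio x y.

Lemma min_ratio_dist_ge0 x y : 0 <= min_ratio_dist x y.
Proof. by rewrite subr_ge0 min_ratio_le1. Qed.

Lemma min_ratio_dist_le1 x y : min_ratio_dist x y <= 1.
Proof. by rewrite gerBl min_ratio_ge0. Qed.

Lemma min_ratio_distxx x : min_ratio_dist x x = 0.
Proof. by rewrite /min_ratio_dist min_ratioxx subrr. Qed.

Lemma min_ratio_dist_eq0 x y : min_ratio_dist x y = 0 -> x = y.
Proof. by move=> /subr0_eq/esym/min_ratio_eq1. Qed.

Lemma min_ratio_distC x y : min_ratio_dist x y = min_ratio_dist y x.
Proof. by rewrite /min_ratio_dist min_ratioC. Qed.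

Lemma min_ratio_dist_triangle y x z :
  min_ratio_dist x z <= min_ratio_dist x y + min_ratio_dist y z.
Proof.
have := min_ratioM_le x y z.
have := mulr_ge0 (min_ratio_dist_ge0 x y) (min_ratio_dist_ge0 y z).
(* With the product [min_ratio x y * min_ratio y z] as an atom, the goal is the sum of the two facts
   above. *)
by rewrite /min_ratio_dist; nra.
Qed.

End MinRatio.

Definition min_ratio_metric (R : realType) : isMetric R {posnum R} :=
  isMetric.Build R {posnum R} (@min_ratio_distxx R) (@min_ratio_dist_eq0 R)
    (@min_ratio_distC R) (@min_ratio_dist_triangle R).

Theorem theorem2p13 (R : realType) : triad_inconsistency_indicator (@Kii R).
Proof.
(* Holds by conversion, as [min_ratio x y] lists [y / x] first, matching [b / (a * c)]. *)
have KiiE a b c : @Kii R a b c = min_ratio_dist (a%:num * c%:num)%:pos b by [].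
have Kii_le1 (a b c : {posnum R}) : Kii a b c <= 1.
  by rewrite KiiE min_ratio_dist_le1.
(* The bound 1 also serves as the constant [M]. *)
split=> //; split; last by exists 1.
split=> [x y z|]; first by rewrite KiiE min_ratio_dist_ge0.
by exists (min_ratio_metric R) => x y z; rewrite KiiE.
Qed.
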